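(* Let $T>0$, let $n\ge 1$ be an integer, let $\alpha\in(n-1,n)$, and let $f\colon\mathbb{R}\to\mathbb{R}$ be continuous and $T$-periodic with $f\in AC^n(\mathbb{R})$. If the Riemann-Liouville fractional derivative ${}^{RL}D^\alpha f$ is a bounded function, then ${}^{RL}D^\alpha f$ is an S-asymptotically $T$-periodic function.
   Context: Write $\mathbb{R}^+=[0,+\infty)$. For $\beta>0$, the fractional integral of order $\beta$ is $I^\beta h(t)=\dfrac{1}{\Gamma(\beta)}\displaystyle\int_0^t (t-s)^{\beta-1}h(s)\,ds$, $t>0$. For $\alpha\in(n-1,n)$, the Riemann-Liouville fractional derivative is ${}^{RL}D^\alpha f(t)=\dfrac{d^n}{dt^n}\left(I^{n-\alpha}f\right)(t)$, provided the right-hand side is defined for almost every $t\in\mathbb{R}^+$. $f\in AC^n(\mathbb{R})$ means that $f^{(n-1)}$ exists and is absolutely continuous on every compact interval. A function $\varphi$ in the space $\mathcal{C}_b(\mathbb{R}^+,\mathbb{R})$ of bounded continuous functions on $\mathbb{R}^+$ is S-asymptotically $T$-periodic if $\lim_{t\to+\infty}[\varphi(t+T)-\varphi(t)]=0$.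
   Formalization: A bounded Riemann-Liouville derivative can have jumps, so it need not lie in C_b. S-asymptotic T-periodicity is proved when the derivative is also continuous on R^+; without continuity, the limit of φ(t+T)−φ(t) is proved to be 0 outside a null set. *)

(* Defs.v *)
From HB Require Import structures.
From mathcomp Require Import all_boot all_order all_algebra.
From mathcomp Require Import all_classical all_reals all_analysis.

Set Implicit Arguments.
Unset Strict Implicit.
Unset Printing Implicit Defensive.

Import Order.TTheory GRing.Theory Num.Theory.
Import numFieldNormedType.Exports.

Local Open Scope classical_set_scope.
Local Open Scope ring_scope.

(* Meaningful for a > 0, where the integral converges. *)
Definition Gamma {R : realType} (a : R) : R :=
  (\int[lebesgue_measure]_(x in `]0%R, +oo[) (x `^ (a - 1) * expR (- x)))%R.

(* The fractional integral of order b. The integrand at s = t carries the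
   convention of powR at 0, on a null set. *)
Definition fracint {R : realType} (b : R) (h : R -> R) (t : R) : R :=
  (Gamma b)^-1 *
  (\int[lebesgue_measure]_(s in `[0%R, t]) ((t - s) `^ (b - 1) * h s))%R.

(* derive1n n g is a total function with unspecified values where a limit does not
   exist; nderivable n g t says that the n-th derivative of g at t genuinely
   exists (so that the lower ones exist around t). *)
Fixpoint nderivable {R : realType} (n : nat) (g : R -> R) (t : R) : Prop :=
  if n is m.+1 then
    (\forall s \near t, nderivable m g s) /\ derivable (derive1n m g) t 1
  else True.

Definition abs_continuous {R : realType} (a b : R) (g : R -> R) : Prop :=
  forall e : R, 0 < e -> exists2 d : R, 0 < d &
    forall (m : nat) (u v : 'I_m -> R),
      (forall i, a <= u i /\ u i <= v i /\ v i <= b) ->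
      (forall i j, i != j -> v i <= u j \/ v j <= u i) ->
      \sum_(i < m) (v i - u i) < d ->
      \sum_(i < m) `|g (v i) - g (u i)| < e.

(* AC^n on the whole line, for n >= 1. *)
Definition ACn {R : realType} (n : nat) (f : R -> R) : Prop :=
  (forall x, nderivable n.-1 f x) /\
  (forall a b : R, abs_continuous a b (derive1n n.-1 f)).

(* The Riemann-Liouville derivative of f of order alpha in (n-1, n) is defined
   almost everywhere on [0, +oo[ and is the function phi. As it is only defined
   almost everywhere, phi is any of its representatives; values of phi on
   the negative half-line are irrelevant. *)
Definition is_RL_derivative {R : realType} (n : nat) (alpha : R)
    (f phi : R -> R) : Prop :=
  {ae lebesgue_measure, forall t : R, 0 <= t ->
    nderivable n (fracint (n%:R - alpha) f) t /\
    phi t = derive1n n (fracint (n%:R - alpha) f) t}.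

Definition bounded_Rplus {R : realType} (phi : R -> R) : Prop :=
  exists M : R, forall t : R, 0 <= t -> `|phi t| <= M.

Definition continuous_Rplus {R : realType} (phi : R -> R) : Prop :=
  {within `[0%R, +oo[, continuous phi}.

Definition S_asymptotically_periodic {R : realType} (T : R) (phi : R -> R)
    : Prop :=
  [/\ continuous_Rplus phi, bounded_Rplus phi &
      phi (t + T) - phi t @[t --> +oo] --> (0 : R)].

(* The limit in the previous definition for a function that is only determined
   almost everywhere: t goes to +oo outside a fixed null set. *)
Definition ae_S_asymptotic_limit {R : realType} (T : R) (phi : R -> R) : Prop :=
  exists2 N : set R, (@lebesgue_measure R).-negligible N &
    phi (t + T) - phi t @[t --> within (~` N) +oo] --> (0 : R).

(* Main.v *)
Require Import Defs.
From HB Require Import structures.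
From mathcomp Require Import all_boot all_order all_algebra.
From mathcomp Require Import all_classical all_reals all_analysis.
From mathcomp Require Import measurable_realfun lebesgue_integral_under lra.

Import Order.TTheory GRing.Theory Num.Theory.
Import numFieldNormedType.Exports.

(** Write b = n - alpha, which lies in (0, 1), and let F = I^b f, so that the
    Riemann-Liouville derivative is the n-th derivative of F wherever that
    exists. Everything rests on the increment F (t + T) - F t. In the integral
    defining F (t + T), split [0, t + T] at T and translate the second piece
    by T: as f is T-periodic, that piece is exactly the integral defining
    F t. What is left is
      F (t + T) - F t = Gamma(b)^-1 * \int_0^T (t + T - s)^(b - 1) f(s) ds
    ([fracint_period_increment]). The splitting is legitimate because the
    kernel, although singular at the right end, is integrable
    ([integrable_kernel]).

    For t > 0 the remaining integral stays away from the singularity, since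
    t + T - s >= t there. It can be differentiated under the integral sign as
    often as desired, each derivative lowering the exponent by one
    ([derive1n_window_integral]); its n-th derivative is a constant times the
    same integral with exponent b - 1 - n = - alpha - 1 <= -1, hence is
    O(1 / t) ([cvg_window_integral]).

    Let N be the set of bad points of phi together with its translate by - T;
    both are null. Off N and for t > 0, linearity of the n-th derivative gives
    phi (t + T) - phi t as that vanishing quantity. If phi is continuous, the
    identity extends to all t > 0, because the complement of a null set is
    dense ([continuous_eq_off_negligible]). *)

Set Implicit Arguments.
Unset Strict Implicit.
Unset Printing Implicit Defensive.

Local Open Scope classical_set_scope.
Local Open Scope ring_scope.

(** * Translation invariance of Lebesgue measure *)

Lemma measurable_addr (R : realType) (c : R) :
  measurable_fun [set: measurableTypeR R]
    ((fun x => x + c) : measurableTypeR R -> measurableTypeR R).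
Proof. by apply: measurable_funD; [exact: measurable_id|exact: measurable_cst]. Qed.

(** Both sides are measures in A, and a translation keeps the length of a
    half-open interval; such intervals determine the measure. *)
Lemma lebesgue_measure_addr (R : realType) (c : R) (A : set R) :
  measurable A ->
  lebesgue_measure ((fun x : R => x + c) @^-1` A) = lebesgue_measure A.
Proof.
move=> mA; have ma := @measurable_addr R c.
rewrite -[LHS]/(pushforward (@lebesgue_measure R)
  ((fun x => x + c) : measurableTypeR R -> measurableTypeR R) A).
apply/esym; apply: lebesgue_measure_unique => // _ [[a b]] _ <- /=.
rewrite /pushforward.
rewrite (_ : _ @^-1` _ = `]a - c, b - c]%classic); last first.
  by apply/seteqP; split => x /=; rewrite !in_itv/= ltrBlDr lerBrDr.
rewrite !lebesgue_measure_itv/= !lte_fin ltrD2r -!EFinD.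
by rewrite opprD addrACA opprK addNr addr0.
Qed.

Lemma negligible_addr (R : realType) (c : R) (A : set R) :
  (@lebesgue_measure R).-negligible A ->
  (@lebesgue_measure R).-negligible ((fun x : R => x + c) @^-1` A).
Proof.
move=> [B [mB B0 AB]]; exists ((fun x : R => x + c) @^-1` B); split.
- by rewrite -[X in measurable X]setTI; exact: measurable_addr.
- by rewrite lebesgue_measure_addr.
- by move=> x /= /AB.
Qed.

(** Change of variables along the translation, whose image measure is Lebesgue
    measure again. *)
Lemma Rintegral_addr (R : realType) (c : R) (D : set R) (g : R -> R) :
  measurable D -> measurable_fun [set: R] g ->
  (@lebesgue_measure R).-integrable ((fun x => x + c) @^-1` D)
     (fun x => (g (x + c))%:E) ->
  (\int[lebesgue_measure]_(x in D) g x =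
   \int[lebesgue_measure]_(x in (fun x => x + c) @^-1` D) g (x + c))%R.
Proof.
move=> mD mg ig; rewrite /Rintegral; congr fine.
have ma := @measurable_addr R c.
rewrite -(@integral_pushforward _ _ _ _ _ _ ma lebesgue_measure D
  (EFin \o g) _ ig mD); last exact/measurable_EFinP.
apply: eq_measure_integral => A mA _; apply/esym.
exact: lebesgue_measure_addr.
Qed.

(** * The fractional kernel is integrable *)

Lemma powR_antitone (R : realType) (p x y : R) :
  p <= 0 -> 0 < x -> x <= y -> y `^ p <= x `^ p.
Proof.
move=> p0 x0 xy; have y0 := lt_le_trans x0 xy.
by rewrite /powR !gt_eqF// ler_expR ler_wnM2l// ler_ln.
Qed.

Lemma is_derive_reflected_powR (R : realType) (q c t s : R) : s < t ->
  is_derive s 1 (fun s => c * (t - s) `^ q) (- c * q * (t - s) `^ (q - 1)).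
Proof.
move=> st.
have t0 : 0 < t - s by rewrite subr_gt0.
have h1 : is_derive s 1 (fun s => t - s) (-1).
  apply: is_derive_eq (is_deriveB (is_derive_cst t s 1) (is_derive_id s 1)) _.
  by rewrite sub0r.
have h2 := is_deriveZ c (@is_derive1_comp _ (fun x => x `^ q) (fun s => t - s) s _ _
  (is_derive1_powR q t0) h1).
apply: is_derive_eq h2 _.
by rewrite /GRing.scale/= mulrN1 mulrN mulrA !mulNr.
Qed.

(** For b < 1 the kernel blows up at s = t. Its integral over [0, t - 1/(n+1)]
    is computed from the antiderivative - (t - s)^b / b and never exceeds
    t^b / b; monotone convergence carries the bound to [0, t[. *)
Lemma integrable_powR_kernel (R : realType) (b t : R) : 0 < b ->
  (@lebesgue_measure R).-integrable `[0%R, t]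
    (fun s => ((t - s) `^ (b - 1))%:E).
Proof.
move=> b0; set g := fun s : R => (t - s) `^ (b - 1).
have mg : measurable_fun [set: R] g.
  apply: (measurableT_comp (measurable_powR _)).
  by apply: measurable_funB; [exact: measurable_cst|exact: measurable_id].
apply/integrableP; split; first exact/measurable_EFinP/measurable_funTS.
under eq_integral do rewrite gee0_abs ?lee_fin ?powR_ge0//.
(* The end point s = t carries no mass; without it, the domain is exhausted
   by compact intervals avoiding the singularity. *)
rewrite -integral_itv_bndo_bndc; last exact/measurable_EFinP/measurable_funTS.
pose F n : set R := `[0, t - n.+1%:R^-1]%classic.
have -> : `[0, t[%classic = \bigcup_n F n.
  apply/seteqP; split => [s /=|s [n _]]; rewrite /F /= !in_itv/=.
    move=> /andP[s0 st]; have [n nst] := ltr_add_invr st.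
    by exists n => //=; rewrite /F /= in_itv/= s0 lerBrDr ltW.
  by move=> /andP[-> /le_lt_trans->//]; rewrite ltrBlDr ltrDl.
apply: le_lt_trans (ltry (t `^ b / b)).
apply: (cvge_le _ (ge0_nondecreasing_set_cvg_integral _ _ _ _)); last 4 first.
- move=> m n mn; apply/subsetPset => s; rewrite /F /= !in_itv/= => /andP[->].
  move=> /le_trans ->//; rewrite lerD2l lerN2 lef_pV2 ?posrE// ler_nat.
  by rewrite ltnS.
- by move=> n; exact: measurable_itv.
- by move=> n; exact/measurable_EFinP/measurable_funTS.
- by move=> n x _; rewrite lee_fin powR_ge0.
apply: nearW => n; rewrite /F; set u := t - _.
have tb0 : 0 <= t `^ b / b by rewrite divr_ge0 ?powR_ge0// ltW.
have [u0|u0|<-] := ltgtP 0 u; last 2 first.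
- by rewrite set_itv_ge ?bnd_simp -?ltNge// integral_set0 lee_fin.
- by rewrite set_itv1 integral_set1 lee_fin.
have ut : u < t by rewrite /u ltrBlDr ltrDl.
have dG s : s < t ->
    is_derive s 1 (fun s => - b^-1 * (t - s) `^ b) (g s).
  move=> st; apply: is_derive_eq (is_derive_reflected_powR b (- b^-1) st) _.
  by rewrite opprK mulVf ?mul1r// gt_eqF.
have cG : {within `[0, u], continuous (fun s => - b^-1 * (t - s) `^ b)}.
  apply: derivable_within_continuous => s; rewrite in_itv/= => /andP[_ su].
  by have dGs := dG s (le_lt_trans su ut); exact: ex_derive.
rewrite (@continuous_FTC2 _ g (fun s => - b^-1 * (t - s) `^ b) 0 u u0).
- rewrite -EFinB lee_fin subr0 !mulNr opprK addrC mulrC lerBlDr lerDl.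
  by rewrite mulr_ge0 ?powR_ge0// invr_ge0 ltW.
- apply: derivable_within_continuous => s; rewrite in_itv/= => /andP[_ su].
  have st : s < t by exact: le_lt_trans ut.
  have dg := @is_derive_reflected_powR R (b - 1) 1 t s st.
  have : derivable (fun s => 1 * (t - s) `^ (b - 1)) s 1 by exact: ex_derive.
  by under eq_fun do rewrite mul1r.
- have /continuous_within_itvP := cG; move=> /(_ u0)[_ ? ?]; split => //.
  move=> s; rewrite in_itv/= => /andP[_ su].
  by have dGs := dG s (lt_trans su ut); exact: ex_derive.
- move=> s; rewrite in_itv/= => /andP[_ su]; rewrite derive1E.
  by have [] := dG s (lt_trans su ut).
Qed.

Lemma bounded_on_segment (R : realType) (f : R -> R) (a b : R) :
  continuous f ->
  exists2 M, 0 <= M & forall s, s \in `[a, b] -> `|f s| <= M.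
Proof.
move=> cf; have cfab : {within `[a, b], continuous f}.
  exact: continuous_subspaceT.
have [M [_ HM]] := compact_bounded (continuous_compact cfab (@segment_compact _ a b)).
exists (`|M| + 1) => [|s sab]; first by rewrite addr_ge0.
by apply: HM; [rewrite (le_lt_trans (ler_norm _))// ltrDl|exists s].
Qed.

Lemma measurable_kernel (R : realType) (p t : R) (f : R -> R) :
  continuous f -> measurable_fun [set: R] (fun s => (t - s) `^ p * f s).
Proof.
move=> cf; apply: measurable_funM; last exact: continuous_measurable_fun.
apply: (measurableT_comp (measurable_powR _)).
by apply: measurable_funB; [exact: measurable_cst|exact: measurable_id].
Qed.

Lemma integrable_kernel (R : realType) (b t : R) (f : R -> R) :
  0 < b -> continuous f ->
  (@lebesgue_measure R).-integrable `[0%R, t]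
    (fun s => ((t - s) `^ (b - 1) * f s)%:E).
Proof.
move=> b0 cf; have [M M0 fM] := bounded_on_segment 0 t cf.
apply: (@integrableMl _ _ _ lebesgue_measure _ _
  (fun s => ((t - s) `^ (b - 1))%:E) f) => //.
- exact: integrable_powR_kernel.
- apply: measurable_funTS; exact: continuous_measurable_fun.
- exists M; split=> [|x Mx s /= /fM/le_trans]; first exact: num_real.
  by apply; exact: ltW.
Qed.

(** * The increment of a fractional integral over one period *)

(** The part of the fractional integral at t + T, with exponent p in place of
    b - 1 and without the factor 1 / Gamma(b), that comes from the first
    period [0, T]. *)
Definition window_integral {R : realType} (T p : R) (f : R -> R) (t : R) : R :=
  (\int[lebesgue_measure]_(s in `[0%R, T]) ((t + T - s) `^ p * f s))%R.

(** The contribution of [T, t + T] to the fractional integral at t + T is the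
    fractional integral at t, because the kernel depends only on the difference
    of its arguments and f has period T. *)
Lemma fracint_period_increment (R : realType) (T b t : R) (f : R -> R) :
  0 <= T -> 0 < b -> continuous f -> periodic f T -> 0 <= t ->
  fracint b f (t + T) - fracint b f t =
  (Gamma b)^-1 * window_integral T (b - 1) f t.
Proof.
move=> T0 b0 cf fT t0; rewrite /fracint -mulrBr; congr (_ * _).
have ik := @integrable_kernel R b (t + T) f b0 cf.
have TtT : T <= t + T by rewrite lerDr.
pose g s := (t + T - s) `^ (b - 1) * f s.
rewrite /window_integral -/g.
suff <- : (\int[lebesgue_measure]_(s in `[0%R, (t + T)%R]) g s)%R -
    (\int[lebesgue_measure]_(s in `[0%R, T]) g s)%R =
    (\int[lebesgue_measure]_(s in `[0%R, t]) ((t - s) `^ (b - 1) * f s))%R.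
  by rewrite opprB addrCA subrr addr0.
have lo : (BLeft 0 <= BRight T)%O by rewrite bnd_simp.
have hi : (BRight T <= BRight (t + T))%O by rewrite bnd_simp.
rewrite (@Rintegral_itvB _ g _ _ T ik lo hi).
rewrite Rintegral_itv_obnd_cbnd; last first.
  apply: integrableS ik => //; apply: subset_itvr; rewrite bnd_simp//.
have E : (fun x => x + T) @^-1` `[T, t + T] = `[0, t]%classic.
  by apply/seteqP; split => x /=; rewrite !in_itv/= lerDr lerD2r.
have shiftk s : (t + T - (s + T)) `^ (b - 1) * f (s + T) = (t - s) `^ (b - 1) * f s.
  by rewrite fT opprD addrACA subrr addr0.
rewrite (@Rintegral_addr _ T) ?E//.
- by apply: eq_Rintegral => s _; exact: shiftk.
- exact: measurable_kernel.
- apply: eq_integrable (@integrable_kernel R b t f b0 cf) => // s _.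
  by rewrite /g shiftk.
Qed.

(** * Derivatives and decay of the first-period integral *)

Lemma is_derive_translated_powR (R : realType) (p c s x : R) : s < x + c ->
  is_derive x 1 (fun x => (x + c - s) `^ p) (p * (x + c - s) `^ (p - 1)).
Proof.
move=> sxc; have x0 : 0 < x + c - s by rewrite subr_gt0.
have h : is_derive x 1 (fun x => x + c - s) 1.
  apply: is_derive_eq (is_deriveB (is_deriveD (is_derive_id x 1)
    (is_derive_cst c x 1)) (is_derive_cst s x 1)) _.
  by rewrite subr0 addr0.
apply: is_derive_eq (@is_derive1_comp _ (fun x => x `^ p)
  (fun x => x + c - s) x _ _ (is_derive1_powR p x0) h) _.
by rewrite mulr1.
Qed.

(** For t > 0 the integrand has no singularity on [0, T], whatever the
    exponent. *)
Lemma integrable_window (R : realType) (T p t : R) (f : R -> R) :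
  0 < t -> continuous f ->
  (@lebesgue_measure R).-integrable `[0%R, T]
    (fun s => ((t + T - s) `^ p * f s)%:E).
Proof.
move=> t0 cf; apply: (@continuous_compact_integrable _
  (fun s => (t + T - s) `^ p * f s)); first exact: segment_compact.
apply: continuous_in_subspaceT => s; rewrite inE/= in_itv/= => /andP[s0 sT].
apply: cvgM; last exact: cf.
have st : s < t + T by rewrite (le_lt_trans sT)// ltrDr.
suff : {for s, continuous (fun s => (t + T - s) `^ p)} by [].
apply: differentiable_continuous; apply/derivable1_diffP.
have dk := @is_derive_reflected_powR R p 1 (t + T) s st.
rewrite (_ : (fun s => _) = (fun s => 1 * (t + T - s) `^ p)).
  exact: ex_derive.
by apply/funext => u; rewrite mul1r.
Qed.

(** Differentiation under the integral sign near t, on ]t / 2, t + 1[: there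
    x + T - s >= t / 2, and as p - 1 <= 0 this bounds the derivative of the
    kernel by a constant. *)
Lemma is_derive_window_integral (R : realType) (T p t : R) (f : R -> R) :
  p <= 0 -> continuous f -> 0 < t ->
  is_derive t 1 (window_integral T p f) (p * window_integral T (p - 1) f t).
Proof.
move=> p0 cf t0.
pose k x s := (x + T - s) `^ p * f s.
have dk (x s : R) : 0 < x -> s \in `[0, T] ->
    is_derive x 1 (k^~ s) (p * (x + T - s) `^ (p - 1) * f s).
  move=> x0; rewrite in_itv/= => /andP[_ sT].
  have sxT : s < x + T by rewrite (le_lt_trans sT)// ltrDr.
  apply: is_derive_eq (is_deriveM (is_derive_translated_powR p sxT)
    (is_derive_cst (f s) x 1)) _.
  by rewrite scaler0 add0r /GRing.scale/= mulrC.
have [M M0 fM] := bounded_on_segment 0 T cf.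
have tI : `]t / 2, t + 1[%classic t.
  by rewrite /= in_itv/= gtr_pMr// invf_lt1// ltr1n ltrDl ltr01.
have I0 (x : R) : `]t / 2, t + 1[%classic x -> 0 < x.
  by rewrite /= in_itv/= => /andP[+ _]; apply: lt_trans; rewrite divr_gt0.
pose B : R := `|p| * (t / 2) `^ (p - 1) * M.
have B0 (s : R) : 0 <= cst B s by rewrite /= /B !mulr_ge0// powR_ge0.
have iB : (@lebesgue_measure R).-integrable `[0, T] (EFin \o cst B).
  apply: continuous_compact_integrable; first exact: segment_compact.
  by apply: continuous_subspaceT => x; exact: cvg_cst.
have ik (x : R) : `]t / 2, t + 1[%classic x ->
    (@lebesgue_measure R).-integrable `[0, T] (EFin \o k x).
  by move=> /I0 x0; exact: integrable_window.
have d1k (x s : R) : `]t / 2, t + 1[%classic x -> `[0, T]%classic s ->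
    derivable (k^~ s) x 1.
  by move=> /I0 x0 sT; have dks := dk x s x0 sT; exact: ex_derive.
have kB (x s : R) : `]t / 2, t + 1[%classic x -> `[0, T]%classic s ->
    `|partial1of2 k x s| <= cst B s.
  move=> xI sT; have [_] := dk x s (I0 x xI) sT.
  rewrite partial1of2E => ->; rewrite !normrM.
  apply: ler_pM; rewrite ?mulr_ge0//; last exact: fM.
  apply: ler_pM => //; rewrite ger0_norm ?powR_ge0//.
  apply: powR_antitone; [by rewrite subr_le0 (le_trans p0)|by rewrite divr_gt0|].
  move: xI sT; rewrite /= !in_itv/= => /andP[/ltW tx _] /andP[_ sT].
  by rewrite -addrA (le_trans tx)// lerDl subr_ge0.
have mT : measurable (`[0, T]%classic : set (measurableTypeR R)).
  exact: measurable_itv.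
split; first exact: (derivable_under_integral mT tI ik d1k B0 iB kB).
rewrite -derive1E (differentiation_under_integral mT tI ik d1k B0 iB kB).
rewrite /window_integral -RintegralZl//; last exact: integrable_window.
apply: eq_Rintegral => s; rewrite inE => sT.
by rewrite partial1of2E mulrA; have [_ ->] := dk t s t0 sT.
Qed.

Lemma derive1n_window_integral (R : realType) (T p c : R) (f : R -> R) (m : nat)
    (t : R) : p <= 0 -> continuous f -> 0 < t ->
  derive1n m (fun x => c * window_integral T p f x) t =
  c * (\prod_(i < m) (p - i%:R)) * window_integral T (p - m%:R) f t.
Proof.
move=> p0 cf; elim: m t => [|m IH] t t0.
  by rewrite derive1n0 big_ord0 mulr1 subr0.
rewrite derive1nS derive1E; set C := c * _ in IH.
rewrite (@near_eq_derive _ _ _ _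
  (fun x => C * window_integral T (p - m%:R) f x)); last first.
  by near=> x; apply: IH; near: x; exact: lt_nbhsr.
have pm : p - m%:R <= 0 by rewrite subr_le0 (le_trans p0).
have [_] := is_deriveZ C (@is_derive_window_integral R T _ t f pm cf t0).
rewrite /GRing.scale/= => ->.
by rewrite big_ord_recr/= -natr1 opprD !addrA !mulrA.
Unshelve. all: by end_near. Qed.

(** For t >= 1 and s <= T one has (t + T - s)^p <= t^p <= 1 / t, so the integral
    is at most T * sup |f| / t. *)
Lemma cvg_window_integral (R : realType) (T p : R) (f : R -> R) :
  0 <= T -> p <= -1 -> continuous f ->
  window_integral T p f t @[t --> +oo] --> (0 : R).
Proof.
move=> T0 p1 cf; have [M M0 fM] := bounded_on_segment 0 T cf.
apply: norm_cvg0.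
apply: (@squeeze_cvgr _ _ _ _ (cst 0) (fun t => M * T * t^-1)).
- near=> t; rewrite normr_ge0/=.
  have t1 : 1 <= t by near: t; exact: nbhs_pinfty_ge.
  have t0 : 0 < t by exact: lt_le_trans t1.
  have ik := @integrable_window R T p t f t0 cf.
  rewrite (le_trans (le_normr_Rintegral _ ik))//.
  have iB : (@lebesgue_measure R).-integrable `[0, T] (EFin \o cst (M * t^-1)).
    apply: continuous_compact_integrable; first exact: segment_compact.
    by apply: continuous_subspaceT => x; exact: cvg_cst.
  apply: (@le_trans _ _
    (\int[lebesgue_measure]_(s in `[0%R, T]) (cst (M * t^-1) s))%R).
    apply: le_Rintegral => //; first exact: (integrable_norm ik).
    move=> s sT /=; rewrite normrM mulrC ler_pM//; first exact: fM.
    move: sT; rewrite /= in_itv/= => /andP[_ sT].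
    rewrite ger0_norm ?powR_ge0//.
    rewrite -(powR_inv1 (ltW t0)) (le_trans _ (ler_powR t1 p1))//.
    apply: powR_antitone => //; first by rewrite (le_trans p1)// oppr_le0.
    by rewrite -addrA lerDl subr_ge0.
  rewrite Rintegral_cst//= lebesgue_measure_itv/= lte_fin.
  have -> : fine (if 0 < T then (T%:E - 0%:E)%E else 0%E) = T.
    by case: ltgtP T0 => [||<-]//=; rewrite subr0.
  by rewrite mulrAC.
- exact: cvg_cst.
- rewrite -[X in _ --> X](mulr0 (M * T)); apply: cvgM; first exact: cvg_cst.
  apply/gtr0_cvgV0; last exact: cvg_id.
  exact: nbhs_pinfty_gt.
Unshelve. all: by end_near. Qed.

(** * Iterated derivatives of translates and differences *)

Lemma derive1n_translate (R : realType) (g : R -> R) (c : R) (n : nat) :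
  derive1n n (fun x => g (x + c)) = (fun x => derive1n n g (x + c)).
Proof.
elim: n => [|n IH]; first by [].
rewrite !derive1nS IH; apply/funext => x; rewrite /derive1.
by under eq_fun do rewrite -addrA.
Qed.

Lemma nderivable_translate (R : realType) (g : R -> R) (c : R) (n : nat) (t : R) :
  nderivable n g (t + c) -> nderivable n (fun x => g (x + c)) t.
Proof.
elim: n t => [//|n IH] t /= [nb dg]; split.
  have : \forall x \near t, nderivable n g (x + c).
    have ct : (x + c) @[x --> t] --> t + c.
      by apply: cvgD; [exact: cvg_id|exact: cvg_cst].
    exact: (ct _ nb).
  by apply: filterS => x; exact: IH.
rewrite derive1n_translate; move: dg.
rewrite /derivable /=; under [in X in _ -> X]eq_fun do rewrite -addrA.
by [].
Qed.

(** The induction needs the identity F1 - F2 = G around t, not just at t, as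
    each derivative looks at a neighbourhood. *)
Lemma derive1n_sub (R : realType) (F1 F2 G : R -> R) (n : nat) (t : R) :
  (\forall x \near t, F1 x - F2 x = G x) ->
  nderivable n F1 t -> nderivable n F2 t ->
  derive1n n F1 t - derive1n n F2 t = derive1n n G t.
Proof.
elim: n t => [|n IH] t FG; first by move=> _ _; exact: nbhs_singleton FG.
move=> [n1 d1] [n2 d2]; rewrite !derive1nS !derive1E -deriveB//.
apply: near_eq_derive.
have FG' := near_join FG.
by near=> x; apply: IH; near: x.
Unshelve. all: by end_near. Qed.

Lemma derive1n_increment (R : realType) (F G : R -> R) (c : R) (n : nat) (t : R) :
  (\forall x \near t, F (x + c) - F x = G x) ->
  nderivable n F (t + c) -> nderivable n F t ->
  derive1n n F (t + c) - derive1n n F t = derive1n n G t.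
Proof.
move=> FG /nderivable_translate Fc F0.
by rewrite -(derive1n_sub FG Fc F0) derive1n_translate.
Qed.

(** If u and v differed at t, they would differ on a whole interval around t,
    which would then be contained in a null set. *)
Lemma continuous_eq_off_negligible (R : realType) (u v : R -> R) (N : set R)
    (t : R) : (@lebesgue_measure R).-negligible N ->
  {for t, continuous u} -> {for t, continuous v} ->
  (\forall x \near t, ~ N x -> u x = v x) -> u t = v t.
Proof.
move=> [B [mB B0 NB]] cu cv uv; apply/eqP/negPn/negP => /eqP utv.
have d0 : u t - v t != 0 by rewrite subr_eq0; exact/eqP.
have /(cvgr_neq0 _)/(_ d0) nuv : u x - v x @[x --> t] --> u t - v t.
  exact: cvgB.
have : \forall x \near t, B x.
  near=> x; apply: NB; apply: contrapT => Nx.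
  have : u x - v x != 0 by near: x.
  have -> : u x = v x by move: Nx; near: x.
  by rewrite subrr eqxx.
move=> [e /= e0]; rewrite -[X in X `<=` _]/(ball t e) ball_itv => eB.
have : (lebesgue_measure (`](t - e)%R, (t + e)%R[%classic : set R) <=
        lebesgue_measure B)%E.
  by apply: le_measure; rewrite ?inE.
rewrite B0 lebesgue_measure_itv/= lte_fin ltrBlDr -addrA ltrDl addr_gt0//.
by rewrite -EFinB lee_fin opprB addrC subrKA leNgt addr_gt0.
Unshelve. all: by end_near. Qed.

(** * S-asymptotic periodicity *)

Theorem theorem4 (R : realType) (T : R) (n : nat) (alpha : R) (f : R -> R)
    (T_gt0 : 0 < T) (n_ge1 : (1 <= n)%N)
    (alpha_gt : n%:R - 1 < alpha) (alpha_lt : alpha < n%:R)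
    (f_cont : continuous f) (f_per : periodic f T) (f_ACn : ACn n f)
    (phi : R -> R) (phi_RL : is_RL_derivative n alpha f phi)
    (phi_bounded : bounded_Rplus phi) :
  (continuous_Rplus phi -> S_asymptotically_periodic T phi) /\
  ae_S_asymptotic_limit T phi.
Proof.
set b := n%:R - alpha.
have b0 : 0 < b by rewrite subr_gt0.
have b1 : b - 1 <= 0 by rewrite subr_le0 /b lerBlDr addrC -lerBlDr ltW.
pose q := b - 1 - n%:R.
have q1 : q <= -1.
  have n1 : 1 <= n%:R :> R by rewrite ler1n.
  by rewrite /q /b; lra.
pose c := (Gamma b)^-1 * \prod_(i < n) (b - 1 - i%:R).
pose P := [set t : R | 0 <= t -> nderivable n (fracint b f) t /\
  phi t = derive1n n (fracint b f) t].
(* The increment of phi at t involves the derivatives at t and at t + T. *)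
pose N : set R := ~` P `|` (fun x => x + T) @^-1` (~` P).
have negN : (@lebesgue_measure R).-negligible N.
  by apply: negligibleU; [exact: phi_RL|exact/negligible_addr/phi_RL].
have phiE t : 0 < t -> ~ N t ->
    phi (t + T) - phi t = c * window_integral T q f t.
  move=> t0 Nt.
  have Pt : P t by apply: contrapT => nP; apply: Nt; left.
  have PtT : P (t + T) by apply: contrapT => nP; apply: Nt; right.
  have [Ft ->] := Pt (ltW t0).
  have [FtT ->] := PtT (addr_ge0 (ltW t0) (ltW T_gt0)).
  rewrite -derive1n_window_integral//.
  apply: derive1n_increment FtT Ft.
  near=> x; apply: (fracint_period_increment (ltW T_gt0) b0 f_cont f_per).
  by near: x; exact: lt_le_nbhsr.
have cvgE : c * window_integral T q f t @[t --> +oo] --> (0 : R).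
  rewrite -[X in _ --> X](mulr0 c); apply: cvgM; first exact: cvg_cst.
  by apply: cvg_window_integral => //; exact: ltW.
split=> [cphi|].
- split=> //.
  move: cvgE; apply: cvg_trans; apply: near_eq_cvg.
  near=> t.
  have t0 : 0 < t by near: t; exact: nbhs_pinfty_gt.
  have [cphi0 _] := (continuous_within_itvcyP 0 phi).1 cphi.
  apply: (@continuous_eq_off_negligible _ (fun x => c * window_integral T q f x)
    (fun x => phi (x + T) - phi x) _ _ negN).
  + have q0 : q <= 0 by rewrite (le_trans q1)// oppr_le0.
    have dw := is_deriveZ c (is_derive_window_integral T q0 f_cont t0).
    by apply: differentiable_continuous; apply/derivable1_diffP; exact: ex_derive.
  + apply: cvgB; last by apply: cphi0; rewrite in_itv/= t0.
    apply: (@cvg_comp _ _ _ (fun x => x + T) phi _ (nbhs (t + T))).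
      by apply: cvgD; [exact: cvg_id|exact: cvg_cst].
    by apply: cphi0; rewrite in_itv/= addr_gt0.
  + near=> x => Nx; apply/esym/phiE => //.
    by near: x; exact: lt_nbhsr.
- exists N => //.
  apply: cvg_trans (cvg_within_filter (~` N) cvgE); apply: near_eq_cvg.
  rewrite near_withinE; near=> t => Nt.
  have t0 : 0 < t by near: t; exact: nbhs_pinfty_gt.
  exact/esym/phiE.
Unshelve. all: by end_near. Qed.
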